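(* Let $\Sigma$ be a finite alphabet, $h:\Sigma^*\to M$ a monoid morphism into a finite monoid, and $L\subseteq\Sigma^*$. Assume that $L$ is $h$-substitutable and that the set $\mathcal P$ of relative primes has finite size $q$. Then the set $\mathcal V_{\mathrm{sat}}$ of tail-saturated valid productions is finite and $$|\mathcal V_{\mathrm{sat}}|\le q^2\, r_{\mathrm{res}}(L,h)\, m_{\mathrm{ex}}(L,h).$$
   Context: $D_L(x)=\{(u,v):uxv\in L\}$; $x\equiv_L y$ iff $D_L(x)=D_L(y)$. $L$ is $h$-substitutable if for all $x,y\in\Sigma^*$, $h(x)=h(y)$ and $D_L(x)\cap D_L(y)\ne\varnothing$ imply $x\equiv_L y$. The relative syntactic congruence $\theta$ is: $x\,\theta\,y$ iff $x\equiv_L y$ and $h(x)=h(y)$; its classes $[x]$ are called relative classes. A relative class is live if $D_L(x)\neq\varnothing$ for its members. The unit class is $[\varepsilon]$. For relative classes: $X\cdot Y=\{xy:x\in X,y\in Y\}$ and $X*Y=[xy]$ for any $x\in X,y\in Y$. A relative prime is a live relative class $P\ne[\varepsilon]$ such that whenever $P=X\cdot Y$ (equality of sets) for relative classes $X,Y$, one of $X,Y$ is $[\varepsilon]$. For a nonempty prime sequence $\alpha=P_1\cdots P_k$ put $\overline\alpha=P_1\cdot\ldots\cdot P_k\subseteq\Sigma^*$ and $[\overline\alpha]=P_1*\cdots*P_k$. For $P\in\mathcal P$ and $\alpha\in\mathcal P^*$ with $|\alpha|\ge2$, the production $P\to\alpha$ is correct if $[\overline\alpha]=P$; $\alpha$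 is pleonastic if some proper contiguous block $\beta$ of $\alpha$ with $|\beta|\ge2$ has $[\overline\beta]\in\mathcal P$; a correct production is valid if its right-hand side is not pleonastic. A valid production written $P\to A\alpha$ with $A\in\mathcal P$, $\alpha\in\mathcal P^+$ is tail-saturated if $\overline\alpha=[\overline\alpha]$ as sets of words. For relative classes $A,P$, $A\backslash P=\{x\in\Sigma^*:Ax\subseteq P\}$, and $\mathrm{Res}(A,P)$ is the set of live relative classes $R$ with $R\subseteq A\backslash P$. Put $r_{\mathrm{res}}(L,h)=\max(\{|\mathrm{Res}(A,P)|:A,P\in\mathcal P\}\cup\{0\})$, $\mathcal R_{\mathrm{rel}}=\bigcup_{A,P\in\mathcal P}\mathrm{Res}(A,P)$, $\mathrm{Ex}(R)=\{\alpha\in\mathcal P^+:\overline\alpha=R\}$, and $m_{\mathrm{ex}}(L,h)=\max(\{|\mathrm{Ex}(R)|:R\in\mathcal R_{\mathrm{rel}}\}\cup\{0\})$ (these quantities are finite under the stated hypotheses). *)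

(* Defs.v *)
From HB Require Import structures.
From mathcomp Require Import all_boot finmap.
From mathcomp Require Import boolp classical_sets functions cardinality.

Set Implicit Arguments.
Unset Strict Implicit.
Unset Printing Implicit Defensive.

Local Open Scope classical_set_scope.

(* The free monoid of words: product [++], unit [[::]]. *)
HB.instance Definition _ (T : choiceType) :=
  isMonoid.Build (seq T) (@catA T) (@cat0s T) (@cats0 T).

(* Number of elements of a finite set; [fset_set] sends an infinite set to
   [fset0], so this is 0 on infinite sets. *)
Definition ncard (T : choiceType) (A : set T) : nat := #|` fset_set A|.

Section RelativeClasses.
Variables (Sigma : finType) (M : Type).
Variables (h : seq Sigma -> M) (L : set (seq Sigma)).

Notation word := (seq Sigma).
Notation lang := (set (seq Sigma)).

Implicit Types (x y u v w : word) (A P R X Y : lang) (a b : seq lang).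

Definition contexts x : set (word * word) :=
  [set uv | L (uv.1 ++ x ++ uv.2)].

Definition synt_equiv x y : Prop := contexts x = contexts y.

Definition substitutable : Prop :=
  forall x y, h x = h y -> contexts x `&` contexts y !=set0 -> synt_equiv x y.

Definition theta x y : Prop := synt_equiv x y /\ h x = h y.

Definition rclass x : lang := [set y | theta x y].

Definition is_rclass X : Prop := exists x, X = rclass x.

Definition live X : Prop := forall x, X x -> contexts x !=set0.

Definition lang_cat X Y : lang := [set x ++ y | x in X & y in Y].

(* X * Y = [xy] for any x in X, y in Y: since theta is a congruence, the union
   of the classes [xy] over all such x, y is a single class, see
   [rclass_mulE]. *)
Definition rclass_mul X Y : lang :=
  \bigcup_(x in X) \bigcup_(y in Y) rclass (x ++ y).

Definition rprime P : Prop :=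
  [/\ is_rclass P, live P, P <> rclass [::] &
    forall X Y, is_rclass X -> is_rclass Y -> P = lang_cat X Y ->
      X = rclass [::] \/ Y = rclass [::]].

Definition rprimes : set lang := [set P | rprime P].

Definition prime_seq a : Prop := forall P, P \in a -> rprime P.

(* For a = P_1 ... P_k: the set product P_1 . ... . P_k and the relative class
   P_1 * ... * P_k. Only used for k > 0, where the final factors {[::]} and
   [rclass [::]] of the folds are neutral, see [yield1] and [yclass1]. *)
Definition yield a : lang := foldr lang_cat [set [::]] a.
Definition yclass a : lang := foldr rclass_mul (rclass [::]) a.

(* The production P -> a is the pair (P, a). *)
Definition production : Type := lang * seq lang.

Definition correct (p : production) : Prop :=
  [/\ rprime p.1, prime_seq p.2, 2 <= size p.2 & yclass p.2 = p.1].

Definition pleonastic a : Prop :=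
  exists b, [/\ infix b a, b <> a, 2 <= size b & rprime (yclass b)].

Definition valid (p : production) : Prop := correct p /\ ~ pleonastic p.2.

Definition tail_saturated (p : production) : Prop :=
  exists A a, p.2 = A :: a /\ yield a = yclass a.

Definition V_sat : set production :=
  [set p | valid p /\ tail_saturated p].

Definition lresidual A P : lang := [set x | forall y, A y -> P (y ++ x)].

Definition Res A P : set lang :=
  [set R | [/\ is_rclass R, live R & R `<=` lresidual A P]].

Definition R_rel : set lang :=
  \bigcup_(A in rprimes) \bigcup_(P in rprimes) Res A P.

Definition Ex R : set (seq lang) :=
  [set a | [/\ a <> [::], prime_seq a & yield a = R]].

(* Maxima over an empty family are 0. All sets whose cardinality is taken are
   finite when h is a morphism to a finite monoid, L is h-substitutable and
   there are finitely many relative primes, see [finite_Res], [finite_R_rel]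
   and [finite_Ex]. *)
Definition r_res : nat :=
  \max_(A <- fset_set rprimes) \max_(P <- fset_set rprimes) ncard (Res A P).

Definition m_ex : nat := \max_(R <- fset_set R_rel) ncard (Ex R).

End RelativeClasses.

Section Facts.
Variables (Sigma : finType) (M : monoidType).
Variables (h : UMagmaMorphism.type (seq Sigma) M).
Variable (L : set (seq Sigma)).
Implicit Types (x y u v w : seq Sigma) (A P R X Y : set (seq Sigma)).

Let hcat x y : h (x ++ y) = (h x * h y)%g.
Proof. exact: (gmulfM (s := h)). Qed.

Lemma theta_cat x x' y y' :
  theta h L x x' -> theta h L y y' -> theta h L (x ++ y) (x' ++ y').
Proof.
move=> [xx' hx] [yy' hy]; split; last by rewrite !hcat hx hy.
apply/seteqP; split=> -[u v]; rewrite /contexts /=.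
- move=> /= Luv.
  have : contexts L x (u, y ++ v) by move: Luv; rewrite /contexts /= -!catA.
  rewrite xx' /contexts /= => Luv'.
  have : contexts L y (u ++ x', v) by move: Luv'; rewrite /contexts /= -!catA.
  by rewrite yy' /contexts /= -!catA.
- move=> /= Luv.
  have : contexts L x' (u, y' ++ v) by move: Luv; rewrite /contexts /= -!catA.
  rewrite -xx' /contexts /= => Luv'.
  have : contexts L y' (u ++ x, v) by move: Luv'; rewrite /contexts /= -!catA.
  by rewrite -yy' /contexts /= -!catA.
Qed.

Lemma rclass_eqP x y : rclass h L x = rclass h L y <-> theta h L x y.
Proof.
split=> [e|[xy hxy]]; first by have : rclass h L y y by []; rewrite -e.
apply/seteqP; split=> z [] xz hxz; split.
- exact: etrans (esym xy) xz.
- exact: etrans (esym hxy) hxz.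
- exact: etrans xy xz.
- exact: etrans hxy hxz.
Qed.

Lemma rclass_mulE x y X Y : is_rclass h L X -> is_rclass h L Y -> X x -> Y y ->
  rclass_mul h L X Y = rclass h L (x ++ y).
Proof.
move=> [x0 ->] [y0 ->] Xx Yy; apply/seteqP; split=> [z|z zxy].
  move=> [x1 Xx1 [y1 Yy1]]; have /rclass_eqP <- := theta_cat Xx Yy.
  by have /rclass_eqP <- := theta_cat Xx1 Yy1.
by exists x => //; exists y.
Qed.

Lemma yield1 P : yield [:: P] = P.
Proof.
apply/seteqP; split=> [_ [x Px [_ -> <-]]|x Px]; first by rewrite cats0.
by exists x => //; exists [::]; rewrite ?cats0.
Qed.

Lemma yclass1 P : is_rclass h L P -> yclass h L [:: P] = P.
Proof.
move=> [x ->] /=; rewrite -{2}(cats0 x); apply: rclass_mulE => //.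
- by exists x.
- by exists [::].
Qed.

Lemma finite_Res A P : finite_set [set: M] -> substitutable h L ->
  rprime h L A -> rprime h L P -> finite_set (Res h L A P).
Proof.
move=> finM subL [[a ->] _ _ _] [clP livP _ _].
pose good m := [set r | h r = m /\ P (a ++ r)].
apply: (sub_finite_set _ (finite_image (fun m => rclass h L (xget [::] (good m))) finM)).
move=> R [[r ->] _ Rsub]; exists (h r) => //.
have Pr : P (a ++ r) by apply: Rsub.
have [hg Pg] : good (h r) (xget [::] (good (h r))) by apply: (@xgetI _ _ (good (h r)) r).
move: (xget _ _) hg Pg => g hg Pg.
apply/rclass_eqP; split=> //; apply: subL => //.
have [[u v] Duv] := livP _ Pr.
case: clP => p eP; move: Pr Pg; rewrite eP => -[pr _] [pg _].
have e : contexts L (a ++ g) = contexts L (a ++ r) by rewrite -pr -pg.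
exists (u ++ a, v); split; last by move: Duv; rewrite /contexts /= -!catA.
by move: Duv; rewrite -e /contexts /= -!catA.
Qed.

Lemma finite_R_rel : finite_set [set: M] -> substitutable h L ->
  finite_set (rprimes h L) -> finite_set (R_rel h L).
Proof.
move=> finM subL finP.
by do 2 (apply: bigcup_finite => // ? ?); apply: finite_Res.
Qed.

Lemma finite_Ex R : finite_set (rprimes h L) -> is_rclass h L R ->
  finite_set (Ex h L R).
Proof.
move=> finP [w ->].
pose S n := [set a | prime_seq h L a /\ size a <= n].
have finS n : finite_set (S n).
  elim: n => [|n IHn].
    by apply: (sub_finite_set _ (finite_set1 [::])) => -[|P a] [].
  apply: (@sub_finite_set _ _ ([set [::]] `|` [set P :: a | P in rprimes h L & a in S n])).
    move=> [|P a] [pa sa]; [by left | right; exists P; last exists a => //].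
      by apply: pa; rewrite inE eqxx.
    by split=> // Q Qa; apply: pa; rewrite inE Qa orbT.
  by rewrite finite_setU; split; [exact: finite_set1 | exact: finite_image2].
apply: (sub_finite_set _ (finS (size w))) => a [_ pa ea]; split=> //.
have : yield a w by rewrite ea.
elim: a w pa {ea} => //= P a IHa w pa [x Px [y ya <-]].
have /IHa : prime_seq h L a by move=> Q Qa; apply: pa; rewrite inE Qa orbT.
move=> /(_ _ ya) say.
have [[p eP] _ nP _] : rprime h L P by apply: pa; rewrite inE eqxx.
rewrite size_cat -add1n leq_add //.
case: x Px => // Pe; case: nP; rewrite eP; apply/rclass_eqP; by rewrite eP in Pe.
Qed.

End Facts.

(* Main.v *)
(* A tail-saturated valid production P -> A a is determined by A, P, the class
   R = yclass a and the sequence a. Since P = A * R, the class R is a live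
   subset of the residual A \ P, and saturation says exactly that a lies in
   Ex(R): there are q choices for each of A and P, then at most r_res for R and
   m_ex for a. *)
Require Import Defs.
From mathcomp Require Import all_boot finmap.
From mathcomp Require Import boolp classical_sets functions cardinality.

Local Open Scope classical_set_scope.

(** Finiteness of [B] matters: [ncard] is 0 on an infinite set, so monotonicity would fail there. *)
Lemma ncard_sub (T : choiceType) (A B : set T) :
  finite_set B -> A `<=` B -> ncard A <= ncard B.
Proof.
move=> finB AB; apply/fsubset_leq_card.
by rewrite -fset_set_sub //; apply: sub_finite_set AB finB.
Qed.

Lemma ncard_image (T U : choiceType) (f : T -> U) (A : set T) :
  finite_set A -> ncard (f @` A) <= ncard A.
Proof. by move=> finA; rewrite /ncard fset_set_image // leq_imfset_card. Qed.

(** Union bound, by induction along an enumeration of [D]: each new [F i] adds at most [m]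
    elements. *)
Lemma ncard_bigcup (I T : choiceType) (D : set I) (F : I -> set T) (m : nat) :
  finite_set D -> (forall i, D i -> finite_set (F i)) ->
  (forall i, D i -> ncard (F i) <= m) ->
  ncard (\bigcup_(i in D) F i) <= ncard D * m.
Proof.
move=> finD finF leF; rewrite -bigsetU_fset_set // [ncard D]/ncard.
have : forall i, i \in (fset_set D : seq I) -> D i.
  by move=> i; rewrite in_fset_set // inE.
elim: (fset_set D : seq I) => [_|i s IHs Ds].
  by rewrite big_nil /ncard fset_set0 cardfs0.
have Di : D i by apply: Ds; rewrite inE eqxx.
have sD j : j \in s -> D j by move=> js; apply: Ds; rewrite inE js orbT.
rewrite big_cons /= mulSn; apply: leq_trans (leq_add (leF _ Di) (IHs sD)).
rewrite /ncard fset_setU; first by rewrite cardfsU leq_subr.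
  exact: finF.
by rewrite -bigcup_seq; apply: bigcup_finite => // j /sD; apply: finF.
Qed.

Section TailSaturated.
Variables (Sigma : finType) (M : monoidType).
Variables (h : UMagmaMorphism.type (seq Sigma) M) (L : set (seq Sigma)).

(** Since [theta] is a congruence, concatenating representatives of the factors gives a
    representative of the product. This lets [yclass h L a] serve as the [R] of [Res]. *)
Lemma is_rclass_yclass (a : seq (set (seq Sigma))) :
  prime_seq h L a -> is_rclass h L (yclass h L a).
Proof.
elim: a => [_|P a IHa pa] /=; first by exists [::].
have [|y ey] := IHa; first by move=> Q Qa; apply: pa; rewrite inE Qa orbT.
have [[x ex] _ _ _] : rprime h L P by apply: pa; rewrite inE eqxx.
exists (x ++ y); apply: rclass_mulE; [by exists x | by exists y | |].
- by rewrite ex.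
- by rewrite ey.
Qed.

Lemma V_sat_sub_bigcup :
  V_sat h L `<=` \bigcup_(A in rprimes h L) \bigcup_(P in rprimes h L)
    \bigcup_(R in Res h L A P) [set (P, A :: a) | a in Ex h L R].
Proof.
move=> [P b] [[[/= pP pAa sz eP] _] [A [a [/= eb ya]]]]; subst P b.
have pA : rprime h L A by apply: pAa; rewrite inE eqxx.
have pa : prime_seq h L a by move=> Q Qa; apply: pAa; rewrite inE Qa orbT.
exists A => //; exists (rclass_mul h L A (yclass h L a)) => //.
(* [Ex] demands a nonempty sequence; [a] is one because [A :: a] has length at least 2. *)
exists (yclass h L a); last by exists a => //; split=> // a0; rewrite a0 in sz.
have cR := is_rclass_yclass _ pa; have [cA _ _ _] := pA.
have mulR y x : A y -> yclass h L a x ->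
    rclass_mul h L A (yclass h L a) (y ++ x).
  by move=> Ay Rx; exists y => //; exists x.
split=> // [x Rx|x Rx y Ay]; last exact: mulR.
(* Liveness of [R]: for a representative [y] of [A], the word [y ++ x] lies in the live class [P],
   and moving [y] into the left context yields a context of [x]. *)
have [y ey] := cA.
have Ay : A y by rewrite ey.
have [_ livP _ _] := pP; have [[u v] Duv] := livP _ (mulR _ _ Ay Rx).
by exists (u ++ y, v); move: Duv; rewrite /contexts /= -!catA.
Qed.

End TailSaturated.

Theorem theorem11p2 (Sigma : finType) (M : monoidType)
    (h : UMagmaMorphism.type (seq Sigma) M) (L : set (seq Sigma))
    (q : nat) (finM : finite_set [set: M]) (subL : substitutable h L)
    (card_rprimes : (rprimes h L #= `I_q)%card) :
  finite_set (V_sat h L) /\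
  ncard (V_sat h L) <= q ^ 2 * r_res h L * m_ex h L.
Proof.
have finP : finite_set (rprimes h L) by exists q.
have eq_q : ncard (rprimes h L) = q by apply: card_fset_set.
have finRes A P : rprimes h L A -> rprimes h L P -> finite_set (Res h L A P).
  exact: finite_Res.
have finEx A P R : Res h L A P R ->
    finite_set [set (P, A :: a) | a in Ex h L R].
  by move=> [cR _ _]; apply/finite_image/finite_Ex.
have finAP A P : rprimes h L A -> rprimes h L P -> finite_set
    (\bigcup_(R in Res h L A P) [set (P, A :: a) | a in Ex h L R]).
  by move=> pA pP; apply: bigcup_finite; [exact: finRes | exact: finEx].
have finA A : rprimes h L A -> finite_set (\bigcup_(P in rprimes h L)
    \bigcup_(R in Res h L A P) [set (P, A :: a) | a in Ex h L R]).
  by move=> pA; apply: bigcup_finite => // P; apply: finAP.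
have finU := bigcup_finite finP finA.
split; first exact: sub_finite_set (@V_sat_sub_bigcup _ _ h L) finU.
apply: leq_trans (ncard_sub _ _ _ finU (@V_sat_sub_bigcup _ _ h L)) _.
(* The two factors [q] are spent one at a time, on the union over [A] and then on the one over
   [P]. *)
rewrite expnS expn1 -!mulnA -{1}eq_q; apply: ncard_bigcup => // A pA.
rewrite -eq_q; apply: ncard_bigcup => // [P|P pP]; first exact: finAP.
(* With [A] and [P] fixed, [ncard (Res h L A P)] is one of the terms of the double maximum
   [r_res]. *)
apply: (@leq_trans (ncard (Res h L A P) * m_ex h L)); last first.
  rewrite leq_mul2r; apply/orP; right.
  apply: (@leq_trans (\max_(P <- fset_set (rprimes h L)) ncard (Res h L A P))).
    by apply: leq_bigmax_seq; rewrite // in_fset_set // inE.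
  by apply: (@leq_bigmax_seq _ _ _
      (fun A => \max_(P <- fset_set (rprimes h L)) ncard (Res h L A P)));
    rewrite // in_fset_set // inE.
apply: ncard_bigcup => [||R RR]; [exact: finRes | exact: finEx |].
have [cR _ _] := RR.
(* With [R] fixed too, the productions are an image of [Ex h L R], whose size is a term of the
   maximum [m_ex] because [R] lies in [R_rel]. *)
apply: leq_trans (ncard_image _ _ _ _ (finite_Ex finP cR)) _.
apply: (@leq_bigmax_seq _ _ _ (fun R => ncard (Ex h L R))) => //.
rewrite in_fset_set; last exact: finite_R_rel.
by rewrite inE; exists A => //; exists P.
Qed.
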